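(* Let $\alpha:\mathbb{C}^2\to\mathbb{R}\times\mathbb{C}=\mathbb{R}^3$ be given by $\alpha(u,v)=\left(\frac{|u|^2}{1+|u|^2+|v|^2},\frac{\bar{u}v}{1+|u|^2+|v|^2}\right)$, and let $B\subset\mathbb{R}^3$ be the open ball of radius $\frac12$ centered at $(\frac12,0,0)$. Then $\alpha$ extends continuously to a function $\widetilde{\alpha}:\mathbb{P}^2_{\mathbb{C}}\to\overline{B}$ given by $$\widetilde{\alpha}([u:v:w])=\left(\frac{|u|^2}{|u|^2+|v|^2+|w|^2},\frac{\overline{u}v}{|u|^2+|v|^2+|w|^2}\right).$$ Moreover, the line at infinity $L_\infty=\{[u:v:w]\in\mathbb{P}^2_{\mathbb{C}}:w=0\}$ maps onto $\partial B$ under $\widetilde\alpha$.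
   Context: $\mathbb{R}^3$ is identified with $\mathbb{R}\times\mathbb{C}$ by $(x,y,z)\mapsto(x,y+iz)$. $\mathbb{C}^2$ is regarded as the affine chart $w=1$ of $\mathbb{P}^2_{\mathbb{C}}$ via $(u,v)\mapsto[u:v:1]$, and $\mathbb{P}^2_{\mathbb{C}}$ carries its usual (analytic) topology. *)

(* Defs.v *)
From HB Require Import structures.
From mathcomp Require Import all_boot all_order all_algebra complex.
From mathcomp Require Import all_classical all_reals all_analysis.

Set Implicit Arguments.
Unset Strict Implicit.
Unset Printing Implicit Defensive.

Import Order.TTheory GRing.Theory Num.Theory.
Import numFieldNormedType.Exports.
Local Open Scope classical_set_scope.
Local Open Scope ring_scope.
Local Open Scope complex_scope.
Local Open Scope quotient_scope.

(* The bare type [R[i]] carries no topology; seen as a numClosedFieldType it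
   gets the topology of its norm. *)
Definition C (R : realType) : numClosedFieldType := R[i].

Definition cabs (R : realType) (z : C R) : R := Normc.normc z.

Definition cconj (R : realType) (z : C R) : C R := conjc z.

Definition ofR (R : realType) (x : R) : C R := x%:C.

Definition R3_to_RC (R : realType) (p : R * R * R) : R * C R :=
  (p.1.1, (p.1.2 +i* p.2 : C R)).

Definition euclid_ball (R : realType) (c : R * R * R) (r : R) :
    set (R * R * R) :=
  [set p | Num.sqrt ((p.1.1 - c.1.1) ^+ 2 + (p.1.2 - c.1.2) ^+ 2
                     + (p.2 - c.2) ^+ 2) < r].

Definition B (R : realType) : set (R * C R) :=
  @R3_to_RC R @` euclid_ball (2^-1, 0, 0) 2^-1.
Arguments B R : clear implicits.

Definition boundary (T : topologicalType) (A : set T) : set T :=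
  closure A `\` interior A.

Definition alpha (R : realType) (p : C R * C R) : R * C R :=
  let: (u, v) := p in
  let n := 1 + cabs u ^+ 2 + cabs v ^+ 2 in
  (cabs u ^+ 2 / n, cconj u * v / ofR n).

(* P^2 is the quotient of C^3 minus the origin (with the subspace topology) by
   the scaling action of C^*. *)
Definition C3nz (R : realType) : set (C R * C R * C R) :=
  [set p | p != (0, 0, 0)].
Arguments C3nz R : clear implicits.

Definition homothetic (R : realType) (p q : C3nz R) : bool :=
  `[< exists2 l : C R, l != 0 &
      set_val q = (l * (set_val p).1.1, l * (set_val p).1.2,
                   l * (set_val p).2) >].

Lemma homothetic_refl (R : realType) : reflexive (@homothetic R).
Proof.
move=> p; apply/asboolP; exists 1; first exact: oner_neq0.
by rewrite !mul1r -!surjective_pairing.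
Qed.

Lemma homothetic_sym_imp (R : realType) (p q : C3nz R) :
  homothetic p q -> homothetic q p.
Proof.
move=> /asboolP[l l0 ql]; apply/asboolP.
exists l^-1; first by rewrite invr_eq0.
by rewrite ql /= !mulKf // -!surjective_pairing.
Qed.

Lemma homothetic_sym (R : realType) : symmetric (@homothetic R).
Proof. by move=> p q; apply/idP/idP; exact: homothetic_sym_imp. Qed.

Lemma homothetic_trans (R : realType) : transitive (@homothetic R).
Proof.
move=> q p r /asboolP[l l0 ql] /asboolP[m m0 rm]; apply/asboolP.
by exists (m * l); [rewrite mulf_neq0 | rewrite rm ql /= !mulrA].
Qed.

Canonical homothetic_equiv (R : realType) :=
  EquivRel (@homothetic R) (@homothetic_refl R) (@homothetic_sym R)
           (@homothetic_trans R).

Definition P2 (R : realType) : Type := {eq_quot (@homothetic_equiv R)}.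
HB.instance Definition _ (R : realType) :=
  Topological.copy (P2 R) (quotient_topology (P2 R)).
HB.instance Definition _ (R : realType) := Quotient.on (P2 R).

(* [u : v : w] *)
Definition hpoint (R : realType) (u v w : C R) (h : (u, v, w) != (0, 0, 0)) :
    P2 R :=
  \pi_(P2 R) (exist _ (u, v, w) (mem_set h) : C3nz R).

Lemma chart_neq0 (R : realType) (u v : C R) : (u, v, 1) != (0, 0, 0) :> _ * C R.
Proof. by apply/eqP => -[_ _ /eqP]; rewrite oner_eq0. Qed.

Definition chart (R : realType) (p : C R * C R) : P2 R :=
  hpoint (chart_neq0 p.1 p.2).

Definition line_at_infinity (R : realType) : set (P2 R) :=
  [set x | exists u v w (h : (u, v, w) != (0, 0, 0)), x = hpoint h /\ w = 0].
Arguments line_at_infinity R : clear implicits.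

(* Main.v *)
(* With n = |u|^2 + |v|^2 + |w|^2, the image of [u : v : w] is at squared
   distance 1/4 - (|u| |w| / n)^2 from the center of B, so it lies in the closed
   ball, and on the sphere when w = 0.  Conversely a point (a, c) of the sphere
   satisfies a^2 + |c|^2 = a, so it is the image of [a : c : 0], except (0, 0),
   which is the image of [0 : 1 : 0]. *)
Require Import Defs.
From HB Require Import structures.
From mathcomp Require Import all_boot all_order all_algebra complex.
From mathcomp Require Import all_classical all_reals all_analysis.
From mathcomp Require Import ring lra.
Import Order.TTheory GRing.Theory Num.Theory.
Import numFieldNormedType.Exports.
Local Open Scope classical_set_scope.
Local Open Scope ring_scope.

(** * Modulus, conjugation and real scalars in the complex plane *)

Lemma cabs_sqr {R : realType} (z : C R) :
  cabs z ^+ 2 = complex.Re z ^+ 2 + complex.Im z ^+ 2.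
Proof. by case: z => a b; rewrite /cabs /= sqr_sqrtr// addr_ge0 ?sqr_ge0. Qed.

Lemma cabsM {R : realType} (x y : C R) : cabs (x * y) = cabs x * cabs y.
Proof. exact: Normc.normcM. Qed.

Lemma cabsV {R : realType} (x : C R) : cabs x^-1 = (cabs x)^-1.
Proof. exact: Normc.normcV. Qed.

Lemma cabs_conj {R : realType} (z : C R) : cabs (cconj z) = cabs z.
Proof. by case: z => a b; rewrite /cabs /= sqrrN. Qed.

Lemma cabs_ofR {R : realType} (x : R) : cabs (ofR x) = `|x|.
Proof. by rewrite /cabs /= expr0n addr0 sqrtr_sqr. Qed.

Lemma cabs0 {R : realType} : cabs (0 : C R) = 0.
Proof. exact: Normc.normc0. Qed.

Lemma cabs1 {R : realType} : cabs (1 : C R) = 1.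
Proof. exact: Normc.normc1. Qed.

Lemma cabs_eq0 {R : realType} (z : C R) : (cabs z == 0) = (z == 0).
Proof.
by apply/eqP/eqP => [|->]; [exact: Normc.eq0_normc|exact: cabs0].
Qed.

(** The norm on [C R] takes its values in [C R] itself; this and the order lemmas on [ofR] carry
    estimates between it and the real-valued [cabs]. *)
Lemma norm_cabs {R : realType} (z : C R) : `|z| = ofR (cabs z).
Proof. by case: z. Qed.

Lemma ofR_le {R : realType} (x y : R) : (ofR x <= ofR y) = (x <= y).
Proof. exact: lecR. Qed.

Lemma ofR_lt {R : realType} (x y : R) : (ofR x < ofR y) = (x < y).
Proof. exact: ltcR. Qed.

Lemma ofRB {R : realType} (x y : R) : ofR (x - y) = ofR x - ofR y.
Proof. exact: rmorphB. Qed.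

Lemma near_cabs_lt {R : realType} (z : C R) (e : R) :
  0 < e -> \forall w \near z, cabs (z - w) < e.
Proof.
move=> e0.
have ofe : 0 < ofR e by rewrite (ofR_lt 0).
have := @near_ball (C R) (C R) z _ ofe; apply: filterS => w.
by rewrite -ofR_lt -norm_cabs.
Qed.

Lemma cabs_continuous {R : realType} : continuous (@cabs R).
Proof.
move=> z; apply/(@cvgrPdist_lt _ _ _ _ (nbhs_filter z)) => e.
move=> /near_cabs_lt-/(_ z); apply: filterS => w.
(* The inequality is moved into [C R], where it is the reverse triangle inequality. *)
apply: le_lt_trans; rewrite -ofR_le -!norm_cabs -cabs_ofR -norm_cabs ofRB.
by rewrite -!norm_cabs; exact: ler_dist_dist.
Qed.

Lemma cconj_continuous {R : realType} : continuous (@cconj R).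
Proof.
move=> z; apply/(@cvgrPdist_lt _ _ _ _ (nbhs_filter z)) => e e0.
have /cvgrPdist_lt/(_ e e0) : (id : C R -> C R) @ z --> (z : C R).
  exact: cvg_id.
(* Conjugation is an isometry, so the same neighbourhood serves. *)
apply: filterS => w; rewrite !norm_cabs -(cabs_conj (z - w)).
by rewrite /cconj rmorphB.
Qed.

Lemma ofR_continuous {R : realType} : continuous (@ofR R).
Proof.
move=> x; apply/(@cvgrPdist_lt _ _ _ _ (nbhs_filter x)) => e e0.
(* The radius lives in [C R]; being positive, it is real. *)
have re : e = ofR (complex.Re e) by rewrite [RHS]RRe_real ?gtr0_real.
have : 0 < complex.Re e by rewrite -ofR_lt -re.
have /cvgrPdist_lt H : (id : R -> R) @ x --> x by exact: cvg_id.
move=> /H; apply: filterS => y.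
by rewrite -ofRB norm_cabs cabs_ofR re ofR_lt.
Qed.

Lemma continuous_pair {T U V : topologicalType} (f : T -> U) (g : T -> V) x :
  {for x, continuous f} -> {for x, continuous g} ->
  {for x, continuous (fun y => (f y, g y))}.
Proof. by move=> cf cg; exact: (cvg_pair cf cg). Qed.

(** * The formula in homogeneous coordinates *)

Definition hnorm2 {R : realType} (p : C R * C R * C R) : R :=
  cabs p.1.1 ^+ 2 + cabs p.1.2 ^+ 2 + cabs p.2 ^+ 2.

(** A total function on C^3, so that continuity can be studied before passing to the quotient;
    division by zero gives it the value 0 at the origin. *)
Definition halpha {R : realType} (p : C R * C R * C R) : R * C R :=
  (cabs p.1.1 ^+ 2 / hnorm2 p, cconj p.1.1 * p.1.2 / ofR (hnorm2 p)).

(** Squared Euclidean distance to the center of the ball, kept squared to avoid roots. *)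
Definition center_dist2 {R : realType} (p : R * C R) : R :=
  (p.1 - 2^-1) ^+ 2 + cabs p.2 ^+ 2.

Lemma hnorm2_neq0 {R : realType} (p : C R * C R * C R) :
  p != (0, 0, 0) -> hnorm2 p != 0.
Proof.
apply: contraNneq => /eqP; rewrite /hnorm2.
rewrite !paddr_eq0 ?addr_ge0 ?sqr_ge0// !sqrf_eq0 !cabs_eq0.
by case: p => [[u v] w] /= /andP[/andP[/eqP-> /eqP->] /eqP->].
Qed.

Lemma halphaE {R : realType} (u v w : C R) :
  halpha (u, v, w) =
    (cabs u ^+ 2 / (cabs u ^+ 2 + cabs v ^+ 2 + cabs w ^+ 2),
     cconj u * v / ofR (cabs u ^+ 2 + cabs v ^+ 2 + cabs w ^+ 2)).
Proof. by []. Qed.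

Lemma hnorm2Z {R : realType} (l u v w : C R) :
  hnorm2 (l * u, l * v, l * w) = cabs l ^+ 2 * hnorm2 (u, v, w).
Proof. by rewrite /hnorm2 /= !cabsM !exprMn !mulrDr. Qed.

Lemma conjM_ofR {R : realType} (z : C R) : cconj z * z = ofR (cabs z ^+ 2).
Proof. by rewrite mulrC -sqr_normc norm_cabs -rmorphXn. Qed.

(** Numerators and denominator all acquire the factor |l|^2, in the second coordinate because
    conj(l) l = |l|^2. *)
Lemma halphaZ {R : realType} (l u v w : C R) : l != 0 ->
  halpha (l * u, l * v, l * w) = halpha (u, v, w).
Proof.
move=> l0; rewrite /halpha hnorm2Z /= cabsM exprMn.
have cl0 : cabs l ^+ 2 != 0 by rewrite sqrf_eq0 cabs_eq0.
congr pair; first by rewrite -mulf_div divff// mul1r.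
have -> : cconj (l * u) * (l * v) = ofR (cabs l ^+ 2) * (cconj u * v).
  by rewrite -conjM_ofR /cconj rmorphM/= mulrACA.
rewrite (_ : ofR (_ * _) = ofR (cabs l ^+ 2) * ofR (hnorm2 (u, v, w))).
  by rewrite -mulf_div divff ?mul1r// -cabs_eq0 cabs_ofR normr_eq0.
exact: rmorphM.
Qed.

(** With U, V, W the squared moduli and n their sum, U^2 + UV = Un - UW, hence (U/n - 1/2)^2 +
    UV/n^2 = 1/4 - UW/n^2. *)
Lemma center_dist2_halpha {R : realType} (p : C R * C R * C R) :
  p != (0, 0, 0) ->
  center_dist2 (halpha p) =
    2^-1 ^+ 2 - (cabs p.1.1 * cabs p.2 / hnorm2 p) ^+ 2.
Proof.
move=> /hnorm2_neq0; rewrite /center_dist2 /= !cabsM cabs_conj cabsV cabs_ofR.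
rewrite !exprMn !exprVn real_normK ?num_real// /hnorm2.
by move=> n0; field; rewrite n0.
Qed.

Lemma center_dist2_halpha_le {R : realType} (p : C R * C R * C R) :
  p != (0, 0, 0) -> center_dist2 (halpha p) <= 2^-1 ^+ 2.
Proof. by move/center_dist2_halpha->; rewrite lerBlDr lerDl sqr_ge0. Qed.

Lemma sphere_halpha {R : realType} (q : R * C R) :
  center_dist2 q = 2^-1 ^+ 2 ->
  exists u v : C R, (u, v, 0 : C R) != (0, 0, 0) /\ halpha (u, v, 0) = q.
Proof.
case: q => a c; rewrite /center_dist2 /= => ac.
have {}ac : a ^+ 2 + cabs c ^+ 2 = a by lra.
have [a0|a0] := eqVneq a 0.
  exists (0 : C R), (1 : C R); split.
    by rewrite !xpair_eqE oner_eq0 andbF.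
  move: ac; rewrite a0 expr0n add0r => /eqP; rewrite sqrf_eq0 cabs_eq0.
  move=> /eqP->; rewrite halphaE cabs0 expr0n mul0r.
  by rewrite /cconj [conjc _]rmorph0 !mul0r.
have ofa0 : ofR a != 0 by rewrite -cabs_eq0 cabs_ofR normr_eq0.
exists (ofR a), c; split; first by rewrite !xpair_eqE negb_and negb_and ofa0.
(* By [ac] the denominator at (a, c, 0) is a itself, so the two coordinates are a^2 / a and a c /
   a. *)
rewrite halphaE cabs0 expr0n addr0 cabs_ofR real_normK ?num_real// ac.
rewrite expr2 mulfK// [cconj (ofR a)]conjc_real -[(a%:C)%C]/(ofR a).
by rewrite mulrAC divff// mul1r.
Qed.

(** * Continuity of the formula and of the squared distance *)

Lemma hnorm2_continuous {R : realType} : continuous (@hnorm2 R).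
Proof.
move=> p; have sq f : {for p, continuous f} ->
    {for p, continuous (fun q : C R * C R * C R => cabs (f q : C R) ^+ 2)}.
  by move=> cf; apply: cvgM; apply: (continuous_comp cf); exact: cabs_continuous.
apply: cvgD; [apply: cvgD|]; apply: sq; [| |exact: cvg_snd].
- apply: (@continuous_comp _ _ _ fst fst); exact: cvg_fst.
- by apply: (@continuous_comp _ _ _ fst snd); [exact: cvg_fst|exact: cvg_snd].
Qed.

Lemma halpha_continuous {R : realType} (p : C R * C R * C R) :
  p != (0, 0, 0) -> {for p, continuous halpha}.
Proof.
move=> /hnorm2_neq0 n0.
have u_cont : {for p, continuous (fun q : C R * C R * C R => q.1.1)}.
  by apply: (@continuous_comp _ _ _ fst fst); exact: cvg_fst.
have v_cont : {for p, continuous (fun q : C R * C R * C R => q.1.2)}.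
  by apply: (@continuous_comp _ _ _ fst snd); [exact: cvg_fst|exact: cvg_snd].
have n_cont := hnorm2_continuous p.
apply: continuous_pair.
- apply: cvgM; last exact: cvgV.
  by apply: cvgM; apply: (continuous_comp u_cont); exact: cabs_continuous.
- apply: cvgM; first apply: cvgM v_cont.
    by apply: (continuous_comp u_cont); exact: cconj_continuous.
  apply: cvgV; first by rewrite -cabs_eq0 cabs_ofR normr_eq0.
  by apply: (continuous_comp n_cont); exact: ofR_continuous.
Qed.

Lemma center_dist2_continuous {R : realType} : continuous (@center_dist2 R).
Proof.
move=> p; apply: cvgD.
  by apply: cvgM; (apply: cvgB; [exact: cvg_fst|exact: cvg_cst]).
have c : {for p, continuous (fun q : R * C R => cabs q.2)}.
  apply: (@continuous_comp _ _ _ snd (@cabs R)); first exact: cvg_snd.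
  exact: cabs_continuous.
exact: (cvgM c c).
Qed.

(** * The ball, its closure and its boundary *)

Lemma B_center_dist2 {R : realType} :
  B R = [set p | center_dist2 p < 2^-1 ^+ 2].
Proof.
have r0 : 0 < 2^-1 ^+ 2 :> R by rewrite exprn_gt0 ?invr_gt0.
have E a b c : euclid_ball (2^-1, 0, 0) 2^-1 (a, b, c) =
    (center_dist2 (a, b +i* c : C R)%C < 2^-1 ^+ 2) :> Prop.
  rewrite /euclid_ball /center_dist2 cabs_sqr /= !subr0 addrA.
  by rewrite -[in RHS](ltr_sqrt _ r0) sqrtr_sqr ger0_norm ?invr_ge0.
apply/seteqP; split.
  by move=> _ [[[a b] c]] + <-; rewrite E.
move=> [a [b c]] /= abc; exists (a, b, c) => //=.
by rewrite E.
Qed.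

(** The sublevel set is closed by continuity. Conversely, moving a point toward the center by a
    fraction t multiplies its squared distance by (1 - t)^2, so for 0 < t < 1 it lies in the open
    ball, and it returns to its start as t tends to 0 from the right. *)
Lemma closure_B {R : realType} :
  closure (B R) = [set p | center_dist2 p <= 2^-1 ^+ 2].
Proof.
rewrite B_center_dist2; apply/seteqP; split.
  have /closure_id-> : closed [set p : R * C R | center_dist2 p <= 2^-1 ^+ 2].
    apply: preimage_closed (@closed_le _ _) => p _.
    exact: center_dist2_continuous.
  by apply: closureS => p /ltW.
move=> [a c] /= ac.
(* [f] runs along the segment from (a, c) to the center of the ball. *)
pose f (t : R) : R * C R := (a + t * (2^-1 - a), ofR (1 - t) * c).
have f0 : f 0 = (a, c).
  by rewrite /f mul0r addr0 subr0 /ofR rmorph1 mul1r.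
have fc : {for 0, continuous f}.
  apply: continuous_pair.
    by apply: cvgD; [exact: cvg_cst|apply: cvgM; [exact: cvg_id|exact: cvg_cst]].
  have oc : {for 0, continuous (fun t : R => ofR (1 - t))}.
    apply: (@continuous_comp _ _ _ (fun t : R => 1 - t) (@ofR R)).
      by apply: cvgB; [exact: cvg_cst|exact: cvg_id].
    exact: ofR_continuous.
  by apply: (cvgM oc); exact: cvg_cst.
have fE t : center_dist2 (f t) = (1 - t) ^+ 2 * center_dist2 (a, c).
  rewrite /center_dist2 /= cabsM cabs_ofR exprMn real_normK ?num_real//.
  by field.
apply: (@closed_cvg _ _ (0^'+) _ f).
- exact: closed_closure.
- near=> t; apply: subset_closure => /=; rewrite fE.
  have t0 : 0 < t by near: t; exact: nbhs_right_gt.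
  have t1 : t < 1 by near: t; apply: nbhs_right_lt.
  apply: le_lt_trans (ler_wpM2l (sqr_ge0 _) ac) _.
  rewrite gtr_pMl ?exprn_gt0 ?invr_gt0//.
  by rewrite expr_lt1 ?subr_ge0 ?ltW// ltrBlDr ltrDl.
- by apply: cvg_at_right_filter; rewrite -f0; exact: fc.
Unshelve. all: end_near.
Qed.

Lemma boundary_B {R : realType} :
  boundary (B R) = [set p | center_dist2 p = 2^-1 ^+ 2].
Proof.
(* The ball is open, so it is its own interior, and removing it from its closure leaves the case of
   equality. *)
rewrite /boundary closure_B (interior_id _).1; last first.
  rewrite B_center_dist2; apply: open_comp (@open_lt _ _) => p _.
  exact: center_dist2_continuous.
rewrite B_center_dist2; apply/seteqP; split => p /=.
  by move=> [pB /negP]; rewrite -leNgt => Bp; apply/eqP; rewrite eq_le pB.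
by move=> ->; rewrite ltxx.
Qed.

Theorem theorem2p6 (R : realType) :
  exists alpha_tilde : P2 R -> R * C R,
    [/\ continuous alpha_tilde,
        forall x : P2 R, closure (B R) (alpha_tilde x),
        forall p : C R * C R, alpha_tilde (chart p) = alpha p,
        forall (u v w : C R) (h : (u, v, w) != (0, 0, 0)),
          alpha_tilde (hpoint h) =
            (let n := cabs u ^+ 2 + cabs v ^+ 2 + cabs w ^+ 2 in
             (cabs u ^+ 2 / n, cconj u * v / ofR n))
      & alpha_tilde @` line_at_infinity R = boundary (B R)].
Proof.
(* The map is computed on the chosen representative; [FE] shows that the choice is harmless, since
   that representative is a nonzero multiple l of p and [halphaZ] absorbs l. *)
pose F (x : P2 R) := halpha (set_val (repr x)).
have FE (p : C3nz R) : F (\pi_(P2 R) p)%qT = halpha (set_val p).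
  rewrite /F; case: piP => q /eqmodP /asboolP[l l0 ->].
  by rewrite halphaZ// -!surjective_pairing.
have FhE u v w (h : (u, v, w) != (0, 0, 0)) : F (hpoint h) = halpha (u, v, w).
  exact: FE.
exists F; split.
- apply/quotient_continuous => p.
  (* Continuity on the quotient is tested after composing with the projection, which gives [halpha]
     restricted to the nonzero triples. *)
  rewrite (_ : F \o _ = halpha \o set_val); last by apply/funext => q; exact: FE.
  apply: continuous_comp; first exact: initial_continuous.
  exact/halpha_continuous/set_mem/(valP p).
- move=> x; rewrite closure_B; apply: center_dist2_halpha_le.
  exact: set_mem (valP (repr x)).
- move=> [u v]; rewrite FhE halphaE /alpha.
  by rewrite cabs1 expr1n (addrC _ 1) addrA.
- by move=> u v w h; exact: FhE.
(* With w = 0 the subtracted square vanishes, so the image is on the sphere; [sphere_halpha] gives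
   the preimages. *)
- rewrite boundary_B; apply/seteqP; split => [_ [_ [u [v [w [h [-> w0]]]]] <-]|q].
    rewrite /= FhE center_dist2_halpha//= w0.
    by rewrite cabs0 mulr0 mul0r expr0n subr0.
  move=> /sphere_halpha[u [v [h <-]]]; exists (hpoint h); last exact: FhE.
  by exists u, v, 0, h.
Qed.
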